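(* Suppose $\widehat{M}_V\neq\emptyset$. Then \[ L_V^+\cap\operatorname{cone}(M_1)=\operatorname{cone}(\widehat{M}_V)=K_U^{\lhd}=C_U^{\lhd} \] and \[ C_U=(\widehat{M}_V)^{\lhd}. \]
   Context: Let $(\Omega,\mathcal{F},\mathbb{P})$ be a probability space and $K\subseteq L^0(\mathbb{P})$ a convex cone (of terminal wealths). Let $a\in[-\infty,\infty)$ and $U:(a,\infty)\to\mathbb{R}$ be increasing, strictly concave, continuously differentiable with $\lim_{x\downarrow a}U'(x)=\infty$ and $\lim_{x\uparrow\infty}U'(x)=0$; if $a=-\infty$, assume moreover $\liminf_{x\to-\infty}\frac{xU'(x)}{U(x)}>1$. Let $V(y)=\sup_{x\in(a,\infty)}\{U(x)-xy\}$ for $y>0$ and $V^+=\max\{V,0\}$. Probability measures $\mathbb{Q}\ll\mathbb{P}$ are identified with their densities $d\mathbb{Q}/d\mathbb{P}\in L^1_+(\mathbb{P})$. Define $M_1=\{\mathbb{Q}\ll\mathbb{P}: X\in L^1(\mathbb{Q})\text{ and }\mathbb{E}_{\mathbb{Q}}[X]\le 0\text{ for all }X\in K\}$. A measure $\mathbb{Q}\ll\mathbb{P}$ has finite loss-entropy if there is $b>0$ with $\mathbb{E}_{\mathbb{P}}\big[V^+\big(\tfrac{d\mathbb{Q}}{d\mathbb{P}}\big)\mathbf{1}_{\{d\mathbb{Q}/d\mathbb{P}\ge b\}}\big]<\infty$; $\widehat{M}_V=\{\mathbb{Q}\in M_1:\mathbb{Q}\text{ has finite loss-entropy}\}$. Let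 $L_U=\bigcap_{\mathbb{Q}\in\widehat{M}_V}L^1(\mathbb{Q})$, let $L_V^+\subseteq L^1(\mathbb{P})$ be the linear span of the densities of elements of $\widehat{M}_V$, with bilinear form $\langle X,X^+\rangle=\mathbb{E}_{\mathbb{P}}[XX^+]$. Let $K_U=\{X\in L_U: X\le\widetilde X\text{ for some }\widetilde X\in K\}$ and $C_U$ the closure of $K_U$ in the weak topology $\sigma(L_U,L_V^+)$. For a set $A$, $\operatorname{cone}(A)$ is the smallest convex cone containing $A$. For nonempty $A\subseteq L_U$, $A^{\lhd}=\{X^+\in L_V^+:\langle X,X^+\rangle\le0\ \forall X\in A\}$; for nonempty $B\subseteq L_V^+$, $B^{\lhd}=\{X\in L_U:\langle X,X^+\rangle\le 0\ \forall X^+\in B\}$. *)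

(* Defs.v *)
From HB Require Import structures.
From mathcomp Require Import all_boot all_order all_algebra.
From mathcomp Require Import all_classical all_reals all_analysis.
Set Implicit Arguments. Unset Strict Implicit. Unset Printing Implicit Defensive.
Import Order.TTheory GRing.Theory Num.Theory numFieldNormedType.Exports.
Local Open Scope classical_set_scope.
Local Open Scope ring_scope.

(* Random variables / densities are represented by measurable functions
   T -> R; statements about L^0-classes are handled via a.e. equality. *)

Section Defs.
Context {d : measure_display} {T : measurableType d} {R : realType}.
Variable P : probability T R.

Definition is_convex_cone (C : set (T -> R)) : Prop :=
  C (fun _ => 0) /\
  (forall f g, C f -> C g -> C (fun w => f w + g w)) /\
  (forall (c : R) f, 0 <= c -> C f -> C (fun w => c * f w)).

Definition cone (A : set (T -> R)) : set (T -> R) :=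
  [set f | forall C, is_convex_cone C -> A `<=` C -> C f].

(* densities dQ/dP of probability measures Q << P *)
Definition is_density (q : T -> R) : Prop :=
  measurable_fun setT q /\ {ae P, forall w, 0 <= q w} /\
  (\int[P]_w (q w)%:E = 1)%E.

(* X in L^1(Q), where q = dQ/dP *)
Definition inL1 (q X : T -> R) : Prop :=
  measurable_fun setT X /\ P.-integrable setT (fun w => (X w * q w)%:E).

Definition expQ (q X : T -> R) : \bar R := (\int[P]_w (X w * q w)%:E)%E.

Definition M1 (K : set (T -> R)) : set (T -> R) :=
  [set q | is_density q /\ forall X, K X -> inL1 q X /\ (expQ q X <= 0)%E].

Definition convV (U : R -> R) (a : \bar R) (y : R) : \bar R :=
  ereal_sup [set (U x - x * y)%:E | x in [set x : R | (a < x%:E)%E]].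

Definition convVplus U a (y : R) : \bar R := maxe (convV U a y) 0.

Definition finite_loss_entropy U a (q : T -> R) : Prop :=
  exists b : R, 0 < b /\
    (\int[P]_(w in [set w | (b <= q w)%R]) convVplus U a (q w) < +oo)%E.

Definition MhatV K U a : set (T -> R) :=
  [set q | M1 K q /\ finite_loss_entropy U a q].

Definition LU K U a : set (T -> R) :=
  [set X | measurable_fun setT X /\ forall q, MhatV K U a q -> inL1 q X].

Definition LVplus K U a : set (T -> R) :=
  [set Z | exists (n : nat) (c : 'I_n -> R) (q : 'I_n -> T -> R),
     (forall i, MhatV K U a (q i)) /\ Z = (fun w => \sum_(i < n) c i * q i w)].

Definition pairing (X Z : T -> R) : \bar R := (\int[P]_w (X w * Z w)%:E)%E.

Definition KU K U a : set (T -> R) :=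
  [set X | LU K U a X /\ exists Xt, K Xt /\ {ae P, forall w, X w <= Xt w}].

(* closure of A (subset of L_U) in the weak topology sigma(L_U, L_V^+):
   every basic weak neighbourhood
   {Y in L_U | |<Y - X, Z_i>| < e, i < n}, Z_i in L_V^+, of X meets A *)
Definition weak_closure K U a (A : set (T -> R)) : set (T -> R) :=
  [set X | LU K U a X /\
     forall (n : nat) (Z : 'I_n -> T -> R) (e : R),
       (forall i, LVplus K U a (Z i)) -> 0 < e ->
       exists Y, A Y /\ LU K U a Y /\
         forall i, (`| pairing (fun w => (Y w - X w)%R) (Z i) | < e%:E)%E].

Definition CU K U a := weak_closure K U a (KU K U a).

Definition polarU K U a (A : set (T -> R)) : set (T -> R) :=
  [set Z | LVplus K U a Z /\ forall X, A X -> (pairing X Z <= 0)%E].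

Definition polarV K U a (B : set (T -> R)) : set (T -> R) :=
  [set X | LU K U a X /\ forall Z, B Z -> (pairing X Z <= 0)%E].

(* equality of the corresponding sets of P-a.e. classes *)
Definition ae_set_eq (A B : set (T -> R)) : Prop :=
  (forall f, A f -> exists g, B g /\ f = g %[ae P]) /\
  (forall g, B g -> exists f, A f /\ f = g %[ae P]).

End Defs.

Definition utility_hyp {R : realType} (U : R -> R) (a : \bar R) : Prop :=
  let I := [set x : R | (a < x%:E)%E] in
  (a < +oo)%E /\
  (forall x y, I x -> I y -> x < y -> U x < U y) /\
  (forall x y t, I x -> I y -> x != y -> 0 < t < 1 ->
     t * U x + (1 - t) * U y < U (t * x + (1 - t) * y)) /\
  (forall x, I x -> derivable U x 1) /\
  (forall x, I x -> {for x, continuous (derive1 U)}) /\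
  (derive1 U x @[x --> +oo] --> 0) /\
  (match a with
   | EFin a' => derive1 U x @[x --> a'^'+] --> +oo
   | ENInf => (derive1 U x @[x --> -oo] --> +oo) /\
            (1 < limf_einf (fun x : R => ((x * derive1 U x) / U x)%:E) (ninfty_nbhs R))%E
   | EPInf => False
   end).

(* Main.v *)
(* The heart of the matter is that every [Z] in [L_V^+] has finite loss-entropy.
   Where [Z = sum_i c_i q_i] is large, it is at most a constant times some [q_i],
   so one needs [V^+ (c y) <= D V^+ (y) + A + B y] for large [y].  When [a] is
   finite, [V^+] is itself linearly bounded.  When [a = -oo], the elasticity
   condition gives [U (2 x) <= 2 m U x] near [-oo] for some [m > 1], hence
   [V (m y) <= 2 m V (y)] up to a linear term, and one iterates.

   An element [Z] of the polar of [K_U] is a.e. nonnegative, as one sees by testing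
   it against [- 1_{Z < 0}]; normalised, it is in [M_1] and of finite loss-entropy,
   so [Z] lies in the cone of [Mhat_V].  The identity for [C_U] is then the bipolar
   theorem: a basic weak neighbourhood involves finitely many functionals, so the
   separation takes place in [R^n]. *)

Require Import Defs.
From HB Require Import structures.
From mathcomp Require Import all_boot all_order all_algebra.
From mathcomp Require Import all_classical all_reals all_analysis.
From mathcomp Require Import measurable_realfun ring lra.
Set Implicit Arguments. Unset Strict Implicit. Unset Printing Implicit Defensive.
Import Order.TTheory GRing.Theory Num.Theory numFieldNormedType.Exports.
Local Open Scope classical_set_scope.
Local Open Scope ring_scope.

(** * Tangent lines of the utility *)

Lemma utility_tangent (R : realType) (U : R -> R) (a : \bar R) (x1 x : R) :
  utility_hyp U a -> (a < x1%:E)%E -> (a < x%:E)%E ->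
  U x <= U x1 + U^`()%classic x1 * (x - x1).
Proof.
move=> [_ [_ [conc [der _]]]] ax1 ax.
have [->|xx1] := eqVneq x x1; first by rewrite subrr mulr0 addr0.
pose h := x - x1.
have df : differentiable U x1 by apply/derivable1_diffP; exact: der.
have dh : derivable U x1 h by exact: diff_derivable.
have Dh : 'D_h U x1 = U^`()%classic x1 * h.
  rewrite derive1E (deriveE _ df) (deriveE _ df) -{1}[h]mulr1 [h * 1]/(h *: (1:R)).
  by rewrite linearZ /= mulrC.
rewrite -lerBlDl -Dh /derive.
(* The directional derivative along [h = x - x1] is the limit of these quotients as [t] decreases to
   [0]; for [0 < t < 1] concavity makes each at least [U x - U x1]. *)
set F := fun t : R => t^-1 *: ((U \o shift x1) (t *: h) - U x1).
have cF : F t @[t --> 0^'+] --> lim (F t @[t --> 0^']).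
  by apply: cvg_dnbhs_at_right; exact: dh.
rewrite -(cvg_lim _ cF)//; apply: limr_ge; first by apply/cvg_ex; eexists; exact: cF.
near=> t.
have t0 : 0 < t by near: t; exact: nbhs_right_gt.
have t1 : t < 1 by near: t; exact: nbhs_right_lt.
rewrite /F /= [t^-1 *: _]mulrC ler_pdivlMr//.
have := conc x x1 t ax ax1 xx1; rewrite t0 t1 => /(_ isT).
have -> : t * x + (1 - t) * x1 = t * h + x1 by rewrite /h; ring.
rewrite -[t *: h]/(t * h); set u := U (_ + _); lra.
Unshelve. all: by end_near.
Qed.

(** * The positive part of the convex conjugate *)

Section convex_conjugate.
Context {R : realType}.
Variables (U : R -> R) (a : \bar R).
Local Notation Vp := (convVplus U a).

Lemma convVplus_ge0 y : (0 <= Vp y)%E.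
Proof. by rewrite /convVplus le_max lexx orbT. Qed.

Lemma convVplus_ge x y : (a < x%:E)%E -> ((U x - x * y)%:E <= Vp y)%E.
Proof.
move=> ax; rewrite /convVplus le_max; apply/orP; left.
by apply: ereal_sup_ubound; exists x.
Qed.

Lemma convVplus_le y (W : \bar R) : (0 <= W)%E ->
  (forall x, (a < x%:E)%E -> ((U x - x * y)%:E <= W)%E) -> (Vp y <= W)%E.
Proof.
move=> W0 h; rewrite /convVplus ge_max W0 andbT.
by apply: ge_ereal_sup => _ [x /= ax <-]; exact: h.
Qed.

(** A supremum of functions affine in [y] is lower semicontinuous: an [x] with [U x - x * y > t]
    still works for nearby points. *)
Lemma measurable_convVplus : measurable_fun [set: R] Vp.
Proof.
apply: measurable_maxe; last exact: measurable_cst.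
apply: lower_semicontinuous_measurable => y t.
move=> /ereal_sup_gt[_ [x /= ax <-]]; rewrite lte_fin => tx.
exists [set z | t < U x - x * z].
  have cx : (fun z => U x - x * z) z @[z --> y] --> U x - x * y.
    by apply: cvgB; [exact: cvg_cst|apply: cvgM; [exact: cvg_cst|exact: cvg_id]].
  exact: (cvgr_gt _ cx).
move=> z /= tz; apply: (@lt_le_trans _ _ (U x - x * z)%:E); first by rewrite lte_fin.
by apply: ereal_sup_ubound; exists x.
Qed.

End convex_conjugate.

(** * Growth of the conjugate at large arguments *)

Section conjugate_growth.
Context {R : realType}.
Variable U : R -> R.

(** Once [z] exceeds the slope [p] at [a + 1], the tangent there minus [x * z] is nonincreasing in
    [x], so it is bounded by its value at [x = a], which is affine in [z]. *)
Lemma convVplus_linear (a : R) : utility_hyp U a%:E ->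
  exists b A B : R, [/\ 0 < b, 0 <= A, 0 <= B &
    forall z, b <= z -> (convVplus U a%:E z <= (A + B * z)%:E)%E].
Proof.
move=> hU; pose x1 := a + 1; pose p := U^`()%classic x1.
exists (`|p| + 1), `|U x1 - p * x1 + a * p|, `|a|.
split => [||//|z pz]; [by rewrite ltr_wpDl|exact: normr_ge0|].
have z0 : 0 <= z by apply: le_trans pz; rewrite addr_ge0.
apply: convVplus_le => [|x ax]; first by rewrite lee_fin addr_ge0// mulr_ge0.
rewrite lee_fin.
have ax1 : (a%:E < x1%:E)%E by rewrite lte_fin /x1 ltrDl.
have := @utility_tangent R U a%:E x1 x hU ax1 ax; rewrite -/p => tg.
have h1 := ler_norm (U x1 - p * x1 + a * p).
have h2 : (- a) * z <= `|a| * z by rewrite ler_wpM2r// -normrN ler_norm.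
have pz' : 0 <= z - p by have := ler_norm p; lra.
have h3 : 0 <= (x - a) * (z - p).
  by rewrite mulr_ge0// subr_ge0; move: ax; rewrite lte_fin => /ltW.
nra.
Qed.

Lemma utility_ninfty_elasticity : utility_hyp U -oo ->
  exists x0 g : R, [/\ x0 < 0, 1 < g &
    forall x, x <= x0 -> x * U^`()%classic x <= g * U x].
Proof.
move=> hU; have [_ [incr [_ [_ [_ [_ [_ AE]]]]]]] := hU.
have U0 : 0 < U^`()%classic 0.
  have := @utility_tangent R U -oo%E 0 1 hU (ltNyr _) (ltNyr _).
  have := incr 0 1 (ltNyr _) (ltNyr _) ltr01.
  by rewrite subr0 mulr1; lra.
move: AE; rewrite limf_einfE => /ereal_sup_gt[_ [V [M [Mr VM]] <-] gV].
have [g g1 gle] : exists2 g : R, 1 < g & forall x, V x ->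
    g <= x * U^`()%classic x / U x.
  move: gV; set I := ereal_inf _ => I1.
  have ub x : V x -> (I <= (x * U^`()%classic x / U x)%:E)%E.
    by move=> Vx; apply: ereal_inf_lbound; exists x.
  case: I I1 ub => [r||]//.
    by rewrite lte_fin => r1 ub; exists r => // x /ub; rewrite lee_fin.
  (* An infinite infimum would leave no point in [V], so [2] is a mere default. *)
  by move=> _ ub; exists 2 => [|x /ub]; [lra|rewrite leye_eq].
(* Below [M - 1] the point lies in [V]; below the second bound the tangent at [0] is negative, hence
   [U x < 0] and multiplying by [U x] reverses the inequality. *)
pose m := Num.min (M - 1) (- (`|U 0| + 1) / U^`()%classic 0).
exists (Num.min m (-1)), g; split => // [|x].
  by rewrite gt_min; apply/orP; right; lra.
rewrite !le_min -andbA => /and3P[xM xU x1].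
have Ux : U x < 0.
  have := @utility_tangent R U -oo%E 0 x hU (ltNyr _) (ltNyr _).
  rewrite subr0; have := ler_norm (U 0).
  by move: xU; rewrite ler_pdivlMr// mulrC; lra.
have := gle x (VM x _); rewrite ler_ndivlMr//; apply; lra.
Qed.

(** Above the slope at [0], every [x > 0] does no better than [x = 0]; for [x <= 0] the term
    [- x * y] is nondecreasing in [y]. *)
Lemma convVplus_mono : utility_hyp U -oo ->
  exists b : R, 0 < b /\ forall y z, b <= y -> y <= z ->
    (convVplus U -oo y <= convVplus U -oo z)%E.
Proof.
move=> hU; pose p := U^`()%classic 0; exists (`|p| + 1).
split => [|y z py yz]; first by rewrite ltr_wpDl.
apply: convVplus_le => [|x _]; first exact: convVplus_ge0.
have [x0|x0] := leP x 0.
  apply: (le_trans _ (@convVplus_ge R U -oo%E x z (ltNyr _))).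
  by rewrite lee_fin; nra.
apply: (le_trans _ (@convVplus_ge R U -oo%E 0 z (ltNyr _))).
have := @utility_tangent R U -oo%E 0 x hU (ltNyr _) (ltNyr _).
rewrite lee_fin -/p mul0r !subr0 => tg.
have : 0 <= x * (y - p) by rewrite mulr_ge0 ?(ltW x0)//; have := ler_norm p; lra.
by nra.
Qed.

(* Convexity of [-U] turns the elasticity bound into [U (2 x) <= 2 m U x] with
   [m = (1 + g) / 2 > 1], so that [U (2 x) - 2 x m y <= 2 m (U x - x y)]. *)
Lemma convVplus_dilate : utility_hyp U -oo ->
  exists m b A B : R, [/\ 1 < m, 0 < b, 0 <= A, 0 <= B &
    forall y, b <= y ->
      (convVplus U -oo (m * y) <=
       (2 * m)%:E * convVplus U -oo y + (A + B * y)%:E)%E].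
Proof.
move=> hU; have [x0 [g [x00 g1 hg]]] := utility_ninfty_elasticity hU.
pose m := (1 + g) / 2; pose x1 := 2 * x0; pose p := U^`()%classic x1.
have m1 : 1 < m by rewrite /m; lra.
exists m, (`|p| + 1), `|U x1|, (`|x1| * m).
split => // [|y py]; first by rewrite mulr_ge0//; lra.
have y0 : 0 < y by apply: lt_le_trans py; rewrite ltr_wpDl.
have B0 : 0 <= `|U x1| + `|x1| * m * y.
  by rewrite addr_ge0// !mulr_ge0//; lra.
apply: convVplus_le => [|x _].
  by rewrite adde_ge0// mule_ge0 ?convVplus_ge0// lee_fin; lra.
(* The bound [x <= 2 * x0] puts [x / 2] in the range of the elasticity estimate, which is combined
   with the tangent at [x / 2]. *)
have [xx1|xx1] := leP x x1.
  apply: (@le_trans _ _ ((2 * m)%:E * (U (x / 2) - x / 2 * y)%:E)%E).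
    rewrite -EFinM lee_fin.
    have tg := @utility_tangent R U -oo%E (x / 2) x hU (ltNyr _) (ltNyr _).
    have h : x / 2 <= x0 by rewrite /x1 in xx1; lra.
    have := hg _ h.
    have -> : 2 * m = 1 + g by rewrite /m; field.
    have -> : m * y = (1 + g) * y / 2 by rewrite /m; field.
    by move: tg; set D := U^`()%classic _; nra.
  rewrite -[leLHS]adde0; apply: leeD; last by rewrite lee_fin.
  by apply: lee_wpmul2l; [rewrite lee_fin; lra|exact: convVplus_ge (ltNyr _)].
(* To the right of [x1], the tangent at [x1] minus [x * (m * y)] is largest at [x1], as
   [m * y >= p]; its value there gives [A] and [B]. *)
rewrite -[leLHS]add0e; apply: leeD.
  by rewrite mule_ge0 ?convVplus_ge0// lee_fin; lra.
rewrite lee_fin.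
have tg := @utility_tangent R U -oo%E x1 x hU (ltNyr _) (ltNyr _).
rewrite -/p in tg.
have h1 := ler_norm (U x1).
have my : y <= m * y by rewrite ler_peMl ?ltW.
have h2 : (- x1) * (m * y) <= `|x1| * m * y.
  rewrite -mulrA ler_wpM2r//; first by rewrite mulr_ge0//; lra.
  by rewrite -normrN ler_norm.
have h3 : 0 <= (x - x1) * (m * y - p).
  by rewrite mulr_ge0//; [lra|have := ler_norm p; lra].
nra.
Qed.

Lemma convVplus_dilate_iter : utility_hyp U -oo ->
  exists m b : R, [/\ 1 < m, 0 < b & forall n, exists D A B : R,
   [/\ 0 <= D, 0 <= A, 0 <= B & forall y, b <= y ->
      (convVplus U -oo (m ^+ n * y) <=
       D%:E * convVplus U -oo y + (A + B * y)%:E)%E]].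
Proof.
move=> hU; have [m [b [A [B [m1 b0 A0 B0 step]]]]] := convVplus_dilate hU.
exists m, b; split => //; elim=> [|n [D [A' [B' [D0 A'0 B'0 IH]]]]].
  exists 1, 0, 0; split => // y _.
  by rewrite expr0 mul1r mul1e mul0r addr0 adde0.
have m0 : 0 < m by lra.
have m20 : 0 <= 2 * m by lra.
exists (2 * m * D), (2 * m * A' + A), (2 * m * B' + B * m ^+ n).
split; rewrite ?addr_ge0 ?mulr_ge0 ?exprn_ge0//; try lra.
move=> y yb.
have mnb : b <= m ^+ n * y.
  apply: (le_trans yb); rewrite ler_peMl//; first lra.
  by rewrite exprn_ege1// ltW.
rewrite exprS -mulrA; apply: (le_trans (step _ mnb)).
apply: (@le_trans _ _ ((2 * m)%:E * (D%:E * convVplus U -oo y + (A' + B' * y)%:E)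
   + (A + B * (m ^+ n * y))%:E)%E).
  by rewrite leeD2r// lee_wpmul2l ?lee_fin ?IH.
rewrite muleDr//; last first.
  by rewrite ge0_adde_def// inE ?mule_ge0 ?convVplus_ge0 ?lee_fin ?addr_ge0 ?mulr_ge0//; lra.
rewrite muleA -addeA -EFinM -EFinD.
by rewrite le_eqVlt; apply/orP; left; apply/eqP; congr (_ + _)%E; congr EFin; ring.
Qed.

Lemma convVplus_growth (a : \bar R) (c : R) : utility_hyp U a -> 0 < c ->
  exists b D A B : R, [/\ 0 < b, 0 <= D, 0 <= A, 0 <= B & forall y z,
    b <= z -> z <= c * y ->
    (convVplus U a z <= D%:E * convVplus U a y + (A + B * y)%:E)%E].
Proof.
case: a => [a||] hU c0.
- have [b [A [B [b0 A0 B0 h]]]] := convVplus_linear hU.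
  exists b, 0, A, (B * c); split => // [|y z bz zy]; first by rewrite mulr_ge0// ltW.
  rewrite mul0e add0e (le_trans (h _ bz))// lee_fin lerD2l -mulrA.
  by rewrite ler_wpM2l.
- by case: hU => _ [_ [_ [_ [_ [_ []]]]]].
- have [m [b [m1 b0 it]]] := convVplus_dilate_iter hU.
  have [b' [b'0 mono]] := convVplus_mono hU.
  have [n cn] : exists n, c <= m ^+ n.
    (* Bernoulli's inequality shows that the powers of [m] are unbounded. *)
    have bern n : 1 + n%:R * (m - 1) <= m ^+ n.
      elim: n => [|n IH]; first by rewrite expr0 mul0r addr0.
      rewrite exprS -natr1; apply: (@le_trans _ _ (m * (1 + n%:R * (m - 1)))).
        have : 0 <= n%:R * (m - 1) ^+ 2 by rewrite mulr_ge0 ?sqr_ge0.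
        by rewrite expr2; lra.
      by rewrite ler_wpM2l//; lra.
    have m10 : 0 < m - 1 by lra.
    exists (Num.bound (c / (m - 1))); apply: le_trans (bern _).
    have := @archi_boundP R (c / (m - 1)) (ltW (divr_gt0 c0 m10)).
    by rewrite ltr_pdivrMr//; lra.
  have [D [A [B [D0 A0 B0 h]]]] := it n.
  have mn0 : 0 < m ^+ n by rewrite exprn_gt0//; lra.
  (* The threshold [b'] is for monotonicity; [m ^+ n * b] forces [y >= b] as soon as
     [z <= m ^+ n * y]. *)
  exists (Num.max b' (m ^+ n * b)), D, A, B; split => //.
    by rewrite lt_max b'0.
  move=> y z; rewrite ge_max => /andP[b'z bz zy].
  have y0 : 0 < y by rewrite -(pmulr_rgt0 _ c0) (lt_le_trans b'0)// (le_trans b'z).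
  have zm : z <= m ^+ n * y by rewrite (le_trans zy)// ler_wpM2r// ltW.
  have yb : b <= y by rewrite -(ler_pM2l mn0) (le_trans bz).
  by rewrite (le_trans (mono _ _ b'z zm))// h.
Qed.

End conjugate_growth.

(** * Separation of a point from a convex cone in finite dimension *)

(** This is the first-order condition at a minimum, applied below to squared distances along a
    segment. *)
Lemma slope_ge0 (R : realType) (b c : R) : 0 <= c ->
  (forall t, 0 <= t -> t <= 1 -> 0 <= t * b + t ^+ 2 * c) -> 0 <= b.
Proof.
move=> c0 h; rewrite leNgt; apply/negP => b0.
have cb : 0 < c + 1 - b by lra.
(* This [t] is below [1] and turns [b + t * c] into [b * (1 - b) / (c + 1 - b)], which is
   negative. *)
have t0 : 0 < - b / (c + 1 - b) by rewrite divr_gt0//; lra.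
have := h (- b / (c + 1 - b)) (ltW t0).
rewrite ler_pdivrMr// mul1r => /(_ ltac:(lra)).
rewrite expr2 -mulrA -mulrDr pmulr_rge0// leNgt => /negP; apply.
have -> : b + - b / (c + 1 - b) * c = b * (1 - b) / (c + 1 - b) by field; lra.
by rewrite pmulr_llt0 ?invr_gt0// nmulr_rlt0//; lra.
Qed.

Section cone_separation.
Context {R : realType} {n : nat}.
(** The parameters [k] and [w] cover the squared distances to [x] from [v], from a translate
    [v + t u] and from a multiple [(1 - t) v]. *)
Local Notation sqdist k w v := (\sum_(i < n) (k * v ord0 i + w i) ^+ 2).

Lemma sqdist_continuous (k : R) (w : 'I_n -> R) :
  continuous (fun v : 'rV[R]_n => sqdist k w v).
Proof.
move=> v; apply: (@cvg_big _ _ +%R).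
- exact: add_continuous.
- exact: nbhs_filter.
move=> i _.
have c : {for v, continuous (fun u : 'rV[R]_n => k * u ord0 i + w i)}.
  apply: continuousD; last exact: cst_continuous.
  apply: continuousM; first exact: cst_continuous.
  exact: coord_continuous.
exact: (continuous_comp c (@exprn_continuous R 2 _)).
Qed.

(** The closest point lies only in the closure of [D]. Lower bounds pass there by continuity, so the
    closure need not be shown to be a cone. *)
Lemma closure_sqdist_ge (D : set 'rV[R]_n) (r k : R) (w : 'I_n -> R) p :
  (forall v, D v -> r <= sqdist k w v) -> closure D p -> r <= sqdist k w p.
Proof.
move=> Dr; pose E := [set v : 'rV[R]_n | r <= sqdist k w v].
have cE : closed E.
  apply: (@closed_comp _ _ (fun v : 'rV[R]_n => sqdist k w v) [set y | r <= y]).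
    by move=> v _; exact: sqdist_continuous.
  exact: closed_ge.
suff : closure D `<=` E by apply.
by rewrite [E in _ `<=` E](closure_id E).1//; apply: closure_subset.
Qed.

(* The separating functional is [x - p] for [p] the point of [closure D] closest to [x]. *)
Lemma cone_separation (D : set 'rV[R]_n) (x : 'rV[R]_n) (e : R) :
  D 0 -> (forall u v, D u -> D v -> D (u + v)) ->
  (forall (c : R) u, 0 <= c -> D u -> D (c *: u)) ->
  0 < e -> (forall u, D u -> exists i, e <= `|u ord0 i - x ord0 i|) ->
  exists h : 'I_n -> R, (forall u, D u -> \sum_i h i * u ord0 i <= 0) /\
    0 < \sum_i h i * x ord0 i.
Proof.
move=> D0 DD DZ e0 far.
pose w i := - x ord0 i.
pose f (v : 'rV[R]_n) : R := sqdist 1 w v.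
(* Points no farther from [x] than [0] lie in a box of this half-width, because
   [f 0 <= (f 0 + 1) ^+ 2]; this gives a compact set to minimise over. *)
pose r := f 0 + 1.
have f0 v : 0 <= f v by apply: sumr_ge0 => i _; exact: sqr_ge0.
have coordf (v : 'rV[R]_n) i : (v ord0 i - x ord0 i) ^+ 2 <= f v.
  rewrite /f (bigD1 i)//= mul1r lerDl.
  by apply: sumr_ge0 => j _; exact: sqr_ge0.
pose box := [set v : 'rV[R]_n | forall i, `[x ord0 i - r, x ord0 i + r]%classic (v ord0 i)].
have cS : compact (box `&` closure D).
  apply: compact_closedI; last exact: closed_closure.
  apply: (@rV_compact R n (fun i => `[x ord0 i - r, x ord0 i + r]%classic)) => i.
  exact: segment_compact.
have r0 : 0 < r by rewrite ltr_wpDl.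
have boxP v : f v <= f 0 -> box v.
  move=> fv i; have := le_trans (coordf v i) fv.
  rewrite /= in_itv /= => h.
  have : `|v ord0 i - x ord0 i| <= r.
    rewrite -(@ler_pXn2r _ 2) ?nnegrE ?normr_ge0 ?(ltW r0)// real_normK ?num_real//.
    by apply: (le_trans h); rewrite /r; have := f0 0; nra.
  by rewrite ler_norml; lra.
have S0 : (box `&` closure D) 0 by split; [exact: boxP|exact: subset_closure].
have [p /set_mem[pb pD] pmin] := compact_EVT_min (f := f) (ex_intro _ _ S0) cS
  (continuous_subspaceT (@sqdist_continuous 1 w)).
have fp0 : f p <= f 0 by apply: pmin; exact/mem_set.
have pminD v : D v -> f p <= f v.
  move=> Dv; have [/boxP bv|/ltW fv] := leP (f v) (f 0); last exact: le_trans fv.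
  by apply: pmin; apply/mem_set; split => //; exact: subset_closure.
have fpe : 0 < f p.
  apply: (@lt_le_trans _ _ (e ^+ 2)); first by rewrite exprn_gt0.
  apply: (@closure_sqdist_ge D) => // v /far[i ei]; apply: le_trans (coordf v i).
  by rewrite -[leRHS]real_normK ?num_real// ler_pXn2r ?nnegrE ?normr_ge0// ltW.
exists (fun i => x ord0 i - p ord0 i); split.
  (* Moving from [p] to [p + t u] cannot decrease the distance; the slope at [t = 0] is [- 2] times
     the functional at [u]. *)
  move=> u Du; rewrite -oppr_ge0 -(pmulr_rge0 _ (@ltr0n R 2)).
  apply: (@slope_ge0 _ _ (\sum_i u ord0 i ^+ 2)) => [|t t0 t1].
    by apply: sumr_ge0 => i _; exact: sqr_ge0.
  rewrite -(lerD2l (f p)) addr0.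
  have -> : f p + (t * (2 * - (\sum_i (x ord0 i - p ord0 i) * u ord0 i)) +
      t ^+ 2 * \sum_i u ord0 i ^+ 2) = sqdist 1 (fun i => t * u ord0 i + w i) p.
    rewrite -sumrN !mulr_sumr -!big_split /=; apply: eq_bigr => i _.
    by rewrite /w; ring.
  apply: (@closure_sqdist_ge D) => // v Dv.
  apply: (le_trans (pminD _ (DD _ _ Dv (DZ _ _ t0 Du)))).
  by apply: ler_sum => i _; rewrite !mxE !mul1r addrA.
(* Likewise for shrinking [p] to [(1 - t) p]. *)
have hp : 0 <= \sum_i (x ord0 i - p ord0 i) * p ord0 i.
  rewrite -(pmulr_rge0 _ (@ltr0n R 2)).
  apply: (@slope_ge0 _ _ (\sum_i p ord0 i ^+ 2)) => [|t t0 t1].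
    by apply: sumr_ge0 => i _; exact: sqr_ge0.
  rewrite -(lerD2l (f p)) addr0.
  have -> : f p + (t * (2 * (\sum_i (x ord0 i - p ord0 i) * p ord0 i)) +
      t ^+ 2 * \sum_i p ord0 i ^+ 2) = sqdist (1 - t) w p.
    rewrite !mulr_sumr -!big_split /=; apply: eq_bigr => i _.
    by rewrite /w; ring.
  apply: (@closure_sqdist_ge D) => // v Dv.
  have t1' : 0 <= 1 - t by lra.
  apply: (le_trans (pminD _ (DZ _ _ t1' Dv))).
  by apply: ler_sum => i _; rewrite !mxE !mul1r.
have -> : \sum_i (x ord0 i - p ord0 i) * x ord0 i =
    f p + \sum_i (x ord0 i - p ord0 i) * p ord0 i.
  by rewrite -big_split /=; apply: eq_bigr => i _; rewrite /w; ring.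
exact: ltr_wpDr.
Qed.

End cone_separation.

(** * Linearity and monotonicity of integrals and of the pairing *)

Section integral_facts.
Context {d : measure_display} {T : measurableType d} {R : realType}.
Variable P : probability T R.
Implicit Types f g q X Z : T -> R.
Local Notation intP f := (P.-integrable setT (fun w => (f w)%:E)).

Lemma integrable_lin f g (c : R) : intP f -> intP g ->
  intP (fun w => c * f w + g w).
Proof.
by move=> /(integrableZl measurableT c) cf ig; exact: integrableD cf ig.
Qed.

Lemma integral_lin f g (c : R) : intP f -> intP g ->
  (\int[P]_w (c * f w + g w)%:E =
   c%:E * \int[P]_w (f w)%:E + \int[P]_w (g w)%:E)%E.
Proof.
move=> if_ ig; under eq_integral do rewrite EFinD EFinM.
rewrite integralD ?integralZl//; exact: integrableZl.
Qed.

Lemma ae_ge0_integral f : measurable_fun setT f ->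
  {ae P, forall w, 0 <= f w} ->
  (\int[P]_w `|(f w)%:E| = \int[P]_w (f w)%:E)%E.
Proof.
move=> mf f0; apply: ae_eq_integral => //; [|exact/measurable_EFinP|].
  by apply: measurableT_comp => //; exact/measurable_EFinP.
by move: f0; apply: filterS => w f0 _; rewrite gee0_abs// lee_fin.
Qed.

Lemma ae_le_integral f g : intP f -> intP g ->
  {ae P, forall w, f w <= g w} ->
  (\int[P]_w (f w)%:E <= \int[P]_w (g w)%:E)%E.
Proof.
move=> if_ ig fg; have id := integrable_lin (-1) if_ ig.
have : (0 <= \int[P]_w (-1 * f w + g w)%:E)%E.
  rewrite -ae_ge0_integral; [exact: integral_ge0| |].
    exact/measurable_EFinP/(measurable_int P).
  by move: fg; apply: filterS => w; lra.
rewrite integral_lin//.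
have := integrable_fin_num measurableT if_; have := integrable_fin_num measurableT ig.
case: (\int[P]_w (g w)%:E)%E => [y||]// _; case: (\int[P]_w (f w)%:E)%E => [x||]// _.
by rewrite !lee_fin; lra.
Qed.

Lemma density_integrable q : is_density P q -> intP q.
Proof.
move=> [mq [q0 q1]]; apply/integrableP; split; first exact/measurable_EFinP.
by rewrite ae_ge0_integral// q1 ltry.
Qed.

Lemma pairing_linl X Y Z (c : R) : intP (fun w => X w * Z w) ->
  intP (fun w => Y w * Z w) ->
  pairing P (fun w => c * X w + Y w) Z = (c%:E * pairing P X Z + pairing P Y Z)%E.
Proof.
move=> iX iY; rewrite /pairing -integral_lin//.
by apply: eq_integral => w _; congr EFin; ring.
Qed.

Lemma pairing_linr X Z1 Z2 (c : R) : intP (fun w => X w * Z1 w) ->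
  intP (fun w => X w * Z2 w) ->
  pairing P X (fun w => c * Z1 w + Z2 w) = (c%:E * pairing P X Z1 + pairing P X Z2)%E.
Proof.
move=> i1 i2; rewrite /pairing -integral_lin//.
by apply: eq_integral => w _; congr EFin; ring.
Qed.

Lemma pairing_sumr n X (h : 'I_n -> R) (Z : 'I_n -> T -> R) :
  (forall i, intP (fun w => X w * Z i w)) ->
  pairing P X (fun w => \sum_i h i * Z i w) = (\sum_i (h i)%:E * pairing P X (Z i))%E.
Proof.
move=> iX; rewrite /pairing.
transitivity (\int[P]_w (\sum_i (h i)%:E * (X w * Z i w)%:E))%E.
  apply: eq_integral => w _; rewrite mulr_sumr -sumEFin.
  by apply: eq_bigr => i _; rewrite -EFinM; congr EFin; ring.
rewrite integral_sum//; last by move=> i; exact: integrableZl.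
by apply: eq_bigr => i _; rewrite integralZl.
Qed.

End integral_facts.

(** * The spaces [L_U] and [L_V^+] *)

Section duality.
Context {d : measure_display} {T : measurableType d} {R : realType}.
Variables (P : probability T R) (K : set (T -> R)) (U : R -> R) (a : \bar R).
Implicit Types q X Y Z : T -> R.
Local Notation intP f := (P.-integrable setT (fun w => (f w)%:E)).
Local Notation Mh := (MhatV P K U a).
Local Notation L := (LU P K U a).
Local Notation L' := (LVplus P K U a).

Lemma MhatV_density q : Mh q -> is_density P q.
Proof. by case=> [[]]. Qed.

Lemma LU_bounded X : measurable_fun setT X -> (forall w, `|X w| <= 1) -> L X.
Proof.
move=> mX X1; split => // q Mq; split => //.
have [mq _] := MhatV_density Mq.
apply: (@le_integrable _ _ _ _ _ measurableT _ (fun w => (q w)%:E)).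
- by apply/measurable_EFinP; exact: measurable_funM.
- by move=> w _; rewrite !abse_EFin lee_fin normrM ler_piMl.
- exact/density_integrable/MhatV_density.
Qed.

Lemma LVplus0 : L' (fun=> 0).
Proof.
by exists 0, (fun=> 0), (fun _ _ => 0); split=> [[]//|]; apply/funext => w; rewrite big_ord0.
Qed.

Lemma LVplus_lin Z1 Z2 (c : R) : L' Z1 -> L' Z2 -> L' (fun w => c * Z1 w + Z2 w).
Proof.
move=> [n1 [c1 [q1 [M1 ->]]]] [n2 [c2 [q2 [M2 ->]]]].
exists (n1 + n2)%N.
exists (fun i => match fintype.split i with inl j => c * c1 j | inr j => c2 j end).
exists (fun i => match fintype.split i with inl j => q1 j | inr j => q2 j end).
split=> [i|]; first by case: (fintype.split i).
apply/funext => w; rewrite big_split_ord mulr_sumr.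
congr (_ + _); apply: eq_bigr => i _.
  by rewrite (unsplitK (inl i)) mulrA.
by rewrite (unsplitK (inr i)).
Qed.

Lemma LVplus_sum n (h : 'I_n -> R) (Z : 'I_n -> T -> R) :
  (forall i, L' (Z i)) -> L' (fun w => \sum_i h i * Z i w).
Proof.
elim: n h Z => [|n IH] h Z LZ.
  by have := LVplus0; congr L'; apply/funext => w; rewrite big_ord0.
have := LVplus_lin (h ord0) (LZ ord0) (IH (h \o lift ord0) _ (fun i => LZ (lift ord0 i))).
by congr L'; apply/funext => w; rewrite big_ord_recl.
Qed.

Lemma MhatV_LVplus q : Mh q -> L' q.
Proof.
move=> Mq; exists 1, (fun=> 1), (fun=> q); split => //.
by apply/funext => w; rewrite big_ord_recl big_ord0 mul1r addr0.
Qed.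

Lemma LVplus_measurable Z : L' Z -> measurable_fun setT Z.
Proof.
move=> [n [c [q [Mq ->]]]]; apply: measurable_sum => i.
by apply: measurable_funM => //; have [] := MhatV_density (Mq i).
Qed.

Lemma LU_LVplus_integrable X Z : L X -> L' Z -> intP (fun w => X w * Z w).
Proof.
move=> [mX LX] [n [c [q [Mq ->]]]].
have : P.-integrable setT (fun w => \sum_i (c i)%:E * (X w * q i w)%:E)%E.
  apply: integrable_sum => // i _; apply: integrableZl => //.
  by have [] := LX _ (Mq i).
congr integrable; apply/funext => w; rewrite mulr_sumr -sumEFin.
by apply: eq_bigr => i _; rewrite -EFinM; congr EFin; ring.
Qed.

Lemma LU_lin X Y (c : R) : L X -> L Y -> L (fun w => c * X w + Y w).
Proof.
move=> [mX LX] [mY LY]; have mXY : measurable_fun setT (fun w => c * X w + Y w).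
  by apply: measurable_funD => //; exact: measurable_funM.
split => // q Mq; split => //.
have [[_ iX] [_ iY]] := (LX _ Mq, LY _ Mq).
have := integrable_lin c iX iY.
by congr integrable; apply/funext => w; congr EFin; ring.
Qed.

Lemma pairing_fin_num X Z : L X -> L' Z -> pairing P X Z \is a fin_num.
Proof. by move=> LX LZ; exact/integrable_fin_num/LU_LVplus_integrable. Qed.

Lemma pairingB_LU X Y Z : L X -> L Y -> L' Z ->
  pairing P (fun w => Y w - X w) Z = (pairing P Y Z - pairing P X Z)%E.
Proof.
move=> LX LY LZ; have := pairing_linl (-1)
  (LU_LVplus_integrable LX LZ) (LU_LVplus_integrable LY LZ).
rewrite EFinN mulN1e addeC => <-.
by apply: eq_integral => w _; congr EFin; ring.
Qed.

(** * Finite loss-entropy on [L_V^+] *)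

Lemma measurable_ge_set (b : R) q : measurable_fun setT q ->
  measurable [set w | b <= q w].
Proof.
move=> mq; rewrite -[X in measurable X]setTI.
by apply: measurable_fun_le => //; exact: measurable_cst.
Qed.

(* At a point where [Z >= b > 0], some [q_i] satisfies [Z <= c q_i]; the growth of
   [V^+] then bounds [V^+ (Z)] by the sum of the [D V^+ (q_i) + A + B q_i]. *)
Lemma LVplus_finite_loss_entropy Z : utility_hyp U a -> L' Z ->
  finite_loss_entropy P U a Z.
Proof.
move=> hU LZ; have mZ := LVplus_measurable LZ.
case: LZ => n [c [q [Mq ZE]]].
(* As [k] exceeds the sum of the [|c i|], having [Z w > k * q i w] for all [i] would give
   [Z w < Z w] where [Z w > 0]. *)
pose k := \sum_i `|c i| + 1.
have k0 : 0 < k by rewrite ltr_wpDl// sumr_ge0.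
have [b [D [A [B [b0 D0 A0 B0 growth]]]]] := convVplus_growth hU k0.
have /choice[bq bqP] : forall i, exists bi : R, 0 < bi /\
    (\int[P]_(w in [set w | (bi <= q i w)%R]) convVplus U a (q i w) < +oo)%E.
  by move=> i; have [_] := Mq i.
have mq i : measurable_fun setT (q i) by have [] := MhatV_density (Mq i).
(* Then [Z w >= b'] and [Z w <= k * q i w] force [q i w >= bq i], the region where [V^+ (q i)] has
   finite integral. *)
pose b' := b + \sum_i k * bq i.
have bq0 i : 0 <= k * bq i by rewrite mulr_ge0 ?ltW//; have [] := bqP i.
have bb' : b <= b' by rewrite lerDl sumr_ge0.
have bqb' i : k * bq i <= b'.
  by rewrite /b' (bigD1 i)//= addrCA lerDl addr_ge0 ?sumr_ge0// ltW.
have b'0 : 0 < b' by exact: lt_le_trans bb'.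
pose S i := [set w | bq i <= q i w].
have mS i : measurable (S i) by exact: measurable_ge_set.
have mV i : measurable_fun setT (fun w => convVplus U a (q i w)).
  exact: (measurableT_comp (measurable_convVplus U a) (mq i)).
pose V i := (fun w => convVplus U a (q i w)) \_ (S i).
have V0 i w : (0 <= V i w)%E.
  by rewrite /V patchE; case: ifP => // _; exact: convVplus_ge0.
have mVS i : measurable_fun setT (V i).
  exact: ((measurable_restrictT _ (mS i)).1 (measurable_funTS (mV i))).
(* The densities are nonnegative only a.e.; the absolute value makes [G] nonnegative everywhere. *)
pose G i w := (D%:E * V i w + (A + B * `|q i w|)%:E)%E.
have l0 i w : 0 <= A + B * `|q i w| by rewrite addr_ge0// mulr_ge0.
have G0 i w : (0 <= G i w)%E by rewrite adde_ge0// ?mule_ge0 ?lee_fin.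
have ml i : measurable_fun setT (fun w => (A + B * `|q i w|)%:E).
  apply/measurable_EFinP; apply: measurable_funD => //.
  by apply: measurable_funM => //; exact: measurableT_comp.
have mDV i : measurable_fun setT (fun w => (D%:E * V i w)%E).
  exact: measurable_funeM.
have mG i : measurable_fun setT (G i) by apply: emeasurable_funD.
have sG0 w : (0 <= \sum_i G i w)%E by apply: sume_ge0.
have msG : measurable_fun setT (fun w => \sum_i G i w)%E by exact: emeasurable_sum.
exists b'; split => //.
apply: (@le_lt_trans _ _ (\int[P]_w \sum_i G i w)%E); last first.
  rewrite ge0_integral_sum//; apply: lte_sum_pinfty => i _.
  rewrite ge0_integralD//; try by move=> w _; rewrite ?mule_ge0 ?lee_fin.
  rewrite ge0_integralZl ?lee_fin// lte_add_pinfty//.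
    by rewrite /V -integral_mkcond lte_mul_pinfty ?lee_fin//; have [] := bqP i.
  have iq := density_integrable (MhatV_density (Mq i)).
  have := integrable_lin B (integrable_norm iq) (finite_measure_integrable_cst P A measurableT).
  move=> /(integrable_fin_num measurableT); rewrite ltey_eq => h.
  apply/orP; left; move: h; congr (_ \is a fin_num); apply: eq_integral => w _.
  by congr EFin; rewrite /= addrC.
apply: (@le_trans _ _ (\int[P]_(w in [set w | (b' <= Z w)%R]) \sum_i G i w)%E); last first.
  by apply: ge0_subset_integral => //; exact: measurable_ge_set.
apply: ae_ge0_le_integral => //.
- exact: measurable_ge_set.
- by move=> w _; exact: convVplus_ge0.
- by apply: measurable_funTS; exact: (measurableT_comp (measurable_convVplus U a) mZ).
- exact: measurable_funTS.
have : {ae P, forall w, forall i, 0 <= q i w}.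
  by apply: filter_forall => i; have [_ []] := MhatV_density (Mq i).
apply: filterS => w q0 /= bZ.
have Z0 : 0 < Z w by exact: lt_le_trans bZ.
have [i Zi] : exists i, Z w <= k * q i w.
  apply: contrapT => /forallNP no.
  have : Z w <= \sum_i `|c i| * (Z w / k).
    rewrite {1}ZE; apply: ler_sum => i _.
    apply: (@le_trans _ _ (`|c i| * q i w)); first by rewrite ler_wpM2r// ler_norm.
    rewrite ler_wpM2l// ler_pdivlMr// mulrC.
    by have /negP := no i; rewrite -ltNge => /ltW.
  rewrite -mulr_suml mulrCA -{1}[Z w]mulr1 ler_pM2l// ler_pdivlMr// mul1r /k.
  by rewrite gerDl ler10.
have Vi : V i w = convVplus U a (q i w).
  rewrite /V patchE; case: ifPn => // /negP; case; apply/mem_set.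
  by rewrite /S /= -(ler_pM2l k0) (le_trans (bqb' i))// (le_trans bZ).
apply: (le_trans (growth _ _ (le_trans bb' bZ) Zi)).
rewrite (bigD1 i)//= -[leLHS]adde0; apply: leeD; last exact: sume_ge0.
by rewrite /G Vi ger0_norm.
Qed.

(** * Convex cones of dual variables *)

Lemma is_convex_cone_lin (C : set (T -> R)) : C (fun=> 0) ->
  (forall (c : R) f g, 0 <= c -> C f -> C g -> C (fun w => c * f w + g w)) ->
  is_convex_cone C.
Proof.
move=> C0 lin; split => //; split => [f g Cf Cg|c f c0 Cf].
  by have := lin 1 f g ler01 Cf Cg; congr C; apply/funext => w; rewrite mul1r.
by have := lin c f _ c0 Cf C0; congr C; apply/funext => w; rewrite addr0.
Qed.

(** This is [M1] freed from the normalisation: a convex cone containing [M1], hence containing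
    [cone (M1 P K)]. *)
Definition dual_cone : set (T -> R) :=
  [set Z : T -> R | [/\ measurable_fun setT Z, {ae P, forall w, 0 <= Z w} &
    forall X, K X -> intP (fun w => X w * Z w) /\ (pairing P X Z <= 0)%E]].

Lemma is_convex_cone_dual : is_convex_cone dual_cone.
Proof.
have d0 : dual_cone (fun=> 0).
  split => //; first by apply: aeW => w.
  move=> X _; rewrite /pairing.
  have e : (fun w => (X w * 0)%:E) = cst 0%E by apply/funext => w; rewrite mulr0.
  by rewrite e integral0; split => //; exact: integrable0.
have lin (c : R) Z1 Z2 : 0 <= c -> dual_cone Z1 -> dual_cone Z2 ->
    dual_cone (fun w => c * Z1 w + Z2 w).
  move=> c0 [m1 p1 h1] [m2 p2 h2]; split.
  - by apply: measurable_funD => //; exact: measurable_funM.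
  - by move: p1 p2; apply: filterS2 => w w1 w2; rewrite addr_ge0// mulr_ge0.
  move=> X KX; have [i1 le1] := h1 X KX; have [i2 le2] := h2 X KX.
  split.
    have := integrable_lin c i1 i2.
    by congr integrable; apply/funext => w; congr EFin; ring.
  by rewrite pairing_linr// -[0%E in leRHS]adde0; apply: leeD => //; rewrite mule_ge0_le0 ?lee_fin.
exact: is_convex_cone_lin.
Qed.

Lemma M1_dual_cone : M1 P K `<=` dual_cone.
Proof.
by move=> q [[mq [q0 _]] h]; split => // X /h[[_ iX] le]; split.
Qed.

Lemma cone_sub (A C : set (T -> R)) : is_convex_cone C -> A `<=` C -> cone A `<=` C.
Proof. by move=> hC AC f; apply. Qed.

Lemma is_convex_cone_cone (A : set (T -> R)) : is_convex_cone (cone A).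
Proof.
split; first by move=> C [].
split=> [f g hf hg|c f c0 hf] C hC AC; have [_ [CD CZ]] := hC.
  by apply: CD; [exact: hf|exact: hg].
by apply: CZ => //; exact: hf.
Qed.

Lemma sub_cone (A : set (T -> R)) : A `<=` cone A.
Proof. by move=> f Af C _; apply. Qed.

(** Since [Z] is a.e. nonnegative, pairing with an element of [K_U] is dominated by pairing with the
    element of [K] above it. *)
Lemma dual_cone_polar Z : L' Z -> dual_cone Z -> polarU P K U a (KU P K U a) Z.
Proof.
move=> LZ [_ Z0 h]; split => // X [LX [Y [KY XY]]].
have [iY leY] := h Y KY; apply: le_trans leY.
apply: ae_le_integral => //; first exact: LU_LVplus_integrable LX LZ.
by move: Z0 XY; apply: filterS2 => w w0 wY; rewrite ler_wpM2r.
Qed.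

Lemma is_convex_cone_LVplus : is_convex_cone L'.
Proof.
apply: is_convex_cone_lin; first exact: LVplus0.
by move=> c f g _; exact: LVplus_lin.
Qed.

(** * The polar of [K_U] *)

Hypothesis coneK : is_convex_cone K.
Hypothesis mK : forall X, K X -> measurable_fun setT X.
Hypothesis hU : utility_hyp U a.

Lemma K_LU X : K X -> L X.
Proof. by move=> KX; split=> [|q [[_ h] _]]; [exact: mK|have [] := h X KX]. Qed.

Lemma K_KU X : K X -> KU P K U a X.
Proof. by move=> KX; split; [exact: K_LU|exists X; split => //; exact: aeW]. Qed.

Lemma KU0 : KU P K U a (fun=> 0).
Proof. by apply: K_KU; case: coneK. Qed.

Lemma KU_lin X Y (c : R) : 0 <= c -> KU P K U a X -> KU P K U a Y ->
  KU P K U a (fun w => c * X w + Y w).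
Proof.
move=> c0 [LX [X' [KX' XX']]] [LY [Y' [KY' YY']]]; split; first exact: LU_lin.
have [_ [KD KZ]] := coneK.
exists (fun w => c * X' w + Y' w); split; first by apply: KD => //; exact: KZ.
by move: XX' YY'; apply: filterS2 => w wX wY; rewrite lerD// ler_wpM2l.
Qed.

Lemma ae0_of_integral_abs Z : measurable_fun setT Z ->
  (\int[P]_w `|(Z w)%:E| = 0)%E -> {ae P, forall w, Z w = 0}.
Proof.
move=> mZ /(ae_eq_integral_abs P measurableT) h.
have := h (proj2 (measurable_EFinP _ _) mZ); apply: filterS => w /(_ I).
by case.
Qed.

(* Testing against [- 1_{Z < 0}], which lies below [0] and hence in [K_U]. *)
Lemma polar_ge0 Z : polarU P K U a (KU P K U a) Z -> {ae P, forall w, 0 <= Z w}.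
Proof.
move=> [LZ h]; have mZ := LVplus_measurable LZ.
pose N := [set w | Z w < 0].
have mN : measurable N.
  have -> : N = ~` [set w | 0 <= Z w].
    by rewrite /N; apply/seteqP; split => w /=; [rewrite ltNge => /negP|move/negP; rewrite -ltNge].
  by apply: measurableC; exact: measurable_ge_set.
pose X w : R := - \1_N w.
(* The product is nonnegative, so a nonpositive pairing forces it to vanish a.e. *)
have XZ w : X w * Z w = `|X w * Z w|.
  rewrite /X indicE; case: (boolP (w \in N)) => wN; last by rewrite oppr0 mul0r normr0.
  by rewrite ger0_norm// mulN1r oppr_ge0 ltW//; exact: set_mem wN.
have mX : measurable_fun setT X by apply: measurableT_comp => //; exact: measurable_indic.
have LX : L X.
  apply: LU_bounded => // w; rewrite /X normrN indicE.
  by case: (w \in N); rewrite ?normr1 ?normr0.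
have KX : KU P K U a X.
  split => //; exists (fun=> 0); split; first by case: coneK.
  by apply: aeW => w; rewrite /X oppr_le0 indicE.
have : {ae P, forall w, X w * Z w = 0}.
  apply: ae0_of_integral_abs; first exact: measurable_funM.
  apply/eqP; rewrite eq_le integral_ge0// andbT; apply: le_trans (h X KX).
  by rewrite le_eqVlt; apply/orP; left; apply/eqP; apply: eq_integral => w _; rewrite [in RHS]XZ.
apply: filterS => w; rewrite /X indicE.
case: (boolP (w \in N)) => wN.
  by rewrite mulN1r => /eqP; rewrite oppr_eq0 => /eqP ->.
by move=> _; rewrite leNgt; apply/negP => zw; move/negP: wN; apply; exact/mem_set.
Qed.

Lemma polar_cone_MhatV Z : polarU P K U a (KU P K U a) Z ->
  exists g, cone Mh g /\ {ae P, forall w, g w = Z w}.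
Proof.
move=> pZ; have Z0 := polar_ge0 pZ; case: pZ => LZ h.
have mZ := LVplus_measurable LZ.
have iZ : intP Z.
  have L1 : L (fun=> 1) by apply: LU_bounded => // w; rewrite normr1.
  have := LU_LVplus_integrable L1 LZ.
  by congr integrable; apply/funext => w; rewrite mul1r.
have absZ := ae_ge0_integral mZ Z0.
have [m mE] : exists m : R, (\int[P]_w (Z w)%:E = m%:E)%E.
  by have := integrable_fin_num measurableT iZ => /fineK <-; eexists.
have m0 : 0 <= m by rewrite -lee_fin -mE -absZ integral_ge0.
(* A [Z] of mass zero cannot be normalised and is zero only a.e.; this is the one case where [g] and
   [Z] may differ, on a null set. *)
have [m00|mn0] := eqVneq m 0.
  exists (fun=> 0); split; first by case: (is_convex_cone_cone Mh).
  have := @ae0_of_integral_abs Z mZ; rewrite absZ mE m00 => /(_ erefl).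
  by apply: filterS => w ->.
have mp : 0 < m by rewrite lt_neqAle eq_sym mn0.
pose q w := m^-1 * Z w.
have Lq : L' q.
  have := LVplus_lin m^-1 LZ LVplus0.
  by congr L'; apply/funext => w; rewrite addr0.
have Mq : Mh q.
  split; last exact: LVplus_finite_loss_entropy hU Lq.
  split.
    split; first exact: measurable_funM.
    split; first by move: Z0; apply: filterS => w w0; rewrite mulr_ge0 ?invr_ge0.
    under eq_integral do rewrite EFinM.
    by rewrite integralZl// mE -EFinM mulVf.
  move=> X KX; have LX := K_LU KX; split.
    by split; [exact: mK|exact: LU_LVplus_integrable LX Lq].
  rewrite /expQ; have -> : (\int[P]_w (X w * q w)%:E = m^-1%:E * pairing P X Z)%E.
    rewrite /pairing -integralZl//; last exact: LU_LVplus_integrable LX LZ.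
    by apply: eq_integral => w _; rewrite -EFinM; congr EFin; rewrite /q; ring.
  by apply: mule_ge0_le0; [rewrite lee_fin invr_ge0|exact/h/K_KU].
exists (fun w => m * q w); split.
  by have [_ [_ hz]] := is_convex_cone_cone Mh; apply: hz => //; exact: sub_cone.
by apply: aeW => w; rewrite /q mulrA divff// mul1r.
Qed.

(** Minimality of the generated cone gives these inclusions; the one into the polar passes through
    [dual_cone]. *)
Lemma cone_MhatV_sub :
  cone Mh `<=` L' `&` cone (M1 P K) `&` polarU P K U a (KU P K U a).
Proof.
move=> Z cZ.
have LZ : L' Z by apply: cone_sub cZ; [exact: is_convex_cone_LVplus|exact: MhatV_LVplus].
have cM : cone (M1 P K) Z.
  apply: cone_sub cZ; first exact: is_convex_cone_cone.
  by move=> q [Mq _]; exact: sub_cone.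
split => //; apply: dual_cone_polar => //.
exact: cone_sub is_convex_cone_dual M1_dual_cone _ cM.
Qed.

Lemma cone_MhatV_pairing X Z : polarV P K U a Mh X -> cone Mh Z -> (pairing P X Z <= 0)%E.
Proof.
move=> [LX h] cZ.
pose C := [set Z : T -> R | L' Z /\ (pairing P X Z <= 0)%E].
suff : C Z by case.
have lin (c : R) Z1 Z2 : 0 <= c -> C Z1 -> C Z2 -> C (fun w => c * Z1 w + Z2 w).
  move=> c0 [L1 h1] [L2 h2]; split; first exact: LVplus_lin.
  rewrite pairing_linr; [|exact: LU_LVplus_integrable..].
  by rewrite -[0%E in leRHS]adde0; apply: leeD => //; rewrite mule_ge0_le0 ?lee_fin.
have C0 : C (fun=> 0).
  split; first exact: LVplus0.
  by rewrite /pairing integral0_eq// => w _; rewrite mulr0.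
apply: cone_sub cZ; last by move=> q Mq; split; [exact: MhatV_LVplus|exact: h].
exact: is_convex_cone_lin.
Qed.

(** * Weak closure and the bipolar identity *)

Lemma KU_CU : KU P K U a `<=` CU P K U a.
Proof.
move=> X KX; have [LX _] := KX; split => // n Z e LZ e0.
exists X; split => //; split => // i.
by rewrite (pairingB_LU LX LX (LZ i)) subee ?abse0 ?lte_fin//; exact: pairing_fin_num LX (LZ i).
Qed.

(** If the pairing were [x > 0], the weak neighbourhood of [X] of radius [x] for the single
    functional [Z] would contain an element of [K_U] pairing positively with [Z]. *)
Lemma CU_pairing X Z : CU P K U a X -> polarU P K U a (KU P K U a) Z ->
  (pairing P X Z <= 0)%E.
Proof.
move=> [LX cX] [LZ hZ]; have := pairing_fin_num LX LZ.
case E : (pairing P X Z) => [x||]// _; rewrite lee_fin leNgt; apply/negP => x0.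
have [Y [KY [LY]]] := cX 1%N (fun=> Z) x (fun=> LZ) x0.
move=> /(_ ord0); rewrite (pairingB_LU LX LY LZ) E.
have := hZ Y KY; have := pairing_fin_num LY LZ.
case: (pairing P Y Z) => [y||]// _.
by rewrite lee_fin lte_fin ltr_norml => y0 /andP[]; lra.
Qed.

Lemma polarV_CU : polarV P K U a Mh `<=` CU P K U a.
Proof.
move=> X pX; have [LX _] := pX; split => // n Z e LZ e0.
apply: contrapT => no.
(* The map [v] evaluates the functionals defining a neighbourhood that misses [K_U]; the image of
   [K_U] is a convex cone with no point coordinatewise within [e] of [v X]. *)
pose v Y : 'rV[R]_n := \row_i fine (pairing P Y (Z i)).
have vE Y i : L Y -> pairing P Y (Z i) = (v Y ord0 i)%:E.
  by move=> LY; rewrite mxE fineK//; exact: pairing_fin_num LY (LZ i).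
have vlin Y1 Y2 (c : R) : L Y1 -> L Y2 ->
    v (fun w => c * Y1 w + Y2 w) = c *: v Y1 + v Y2.
  move=> L1 L2; apply/rowP => i; apply: EFin_inj; rewrite -vE; last exact: LU_lin.
  rewrite pairing_linl; [|exact: LU_LVplus_integrable _ (LZ i)..].
  by rewrite !vE// !mxE.
have v0 : v (fun=> 0) = 0.
  apply/rowP => i; rewrite !mxE /pairing integral0_eq// => w _.
  by rewrite mul0r.
have sumE Y h : L Y -> pairing P Y (fun w => \sum_i h i * Z i w) =
    (\sum_i h i * v Y ord0 i)%:E.
  move=> LY; rewrite pairing_sumr; last by move=> i; exact: LU_LVplus_integrable LY (LZ i).
  by rewrite -sumEFin; apply: eq_bigr => i _; rewrite vE.
have [|u1 u2 [Y1 KY1 <-] [Y2 KY2 <-]|c u c0 [Y KY <-]|//|_ [Y KY <-]|h [hD hX]] :=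
    @cone_separation R n (v @` KU P K U a) (v X) e.
- by exists (fun=> 0); [exact: KU0|].
- exists (fun w => 1 * Y1 w + Y2 w); first exact: KU_lin.
  by rewrite vlin ?scale1r//; [case: KY1|case: KY2].
- exists (fun w => c * Y w + 0); first exact: KU_lin KU0.
  by rewrite vlin ?v0 ?addr0//; [case: KY|case: KU0].
- apply: contrapT => /forallNP far; apply: no; exists Y; split => //.
  have [LY _] := KY; split => // i.
  rewrite (pairingB_LU LX LY (LZ i)) !vE// -EFinB abse_EFin lte_fin ltNge.
  by apply/negP; exact: far.
(* The separating vector [h] becomes an element of [L_V^+] in the polar of [K_U] with positive
   pairing with [X]; being a.e. in the cone of [Mhat_V], it contradicts the choice of [X]. *)
pose W w := \sum_i h i * Z i w.
have LW : L' W by exact: LVplus_sum.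
have [g [cg gW]] : exists g, cone Mh g /\ {ae P, forall w, g w = W w}.
  apply: polar_cone_MhatV; split => // Y KY; have [LY _] := KY.
  by rewrite sumE// lee_fin; apply: hD; exists Y.
have := cone_MhatV_pairing pX cg.
have -> : pairing P X g = pairing P X W.
  have [[Lg _] _] := cone_MhatV_sub cg.
  apply: ae_eq_integral => //.
  - by case/integrableP: (LU_LVplus_integrable LX Lg).
  - by case/integrableP: (LU_LVplus_integrable LX LW).
  by move: gW; apply: filterS => w -> _.
by rewrite sumE// lee_fin leNgt hX.
Qed.

End duality.

Theorem theorem5p2 (d : measure_display) (T : measurableType d) (R : realType)
  (P : probability T R) (K : set (T -> R)) (U : R -> R) (a : \bar R) :
  is_convex_cone K ->
  (forall X, K X -> measurable_fun setT X) ->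
  utility_hyp U a ->
  MhatV P K U a !=set0 ->
  [/\ ae_set_eq P (LVplus P K U a `&` cone (M1 P K)) (cone (MhatV P K U a)),
      ae_set_eq P (cone (MhatV P K U a)) (polarU P K U a (KU P K U a)),
      polarU P K U a (KU P K U a) = polarU P K U a (CU P K U a)
    & CU P K U a = polarV P K U a (MhatV P K U a)].
Proof.
move=> coneK mK hU _.
have coneP := cone_MhatV_sub (P := P) (K := K) (U := U) (a := a).
have polarP := polar_cone_MhatV coneK mK hU.
have refl (f : T -> R) : f = f %[ae P] by apply: aeW.
split.
- split=> [Z [LZ cZ]|Z cZ]; last by exists Z; split => //; case: (coneP Z cZ).
  (* The passage goes through the polar of [K_U]: measures in [M1] that generate [Z] may lack finite
     loss-entropy, whereas [Z] has it as an element of [L_V^+]. *)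
  have [|g [cg gZ]] := polarP P Z.
    apply: dual_cone_polar => //.
    exact: (cone_sub (is_convex_cone_dual P K) (@M1_dual_cone _ _ _ P K) cZ).
  by exists g; split => //; move: gZ; apply: filterS => w -> _.
- split=> [Z cZ|Z /polarP[g [cg gZ]]]; first by exists Z; split => //; case: (coneP Z cZ).
  by exists g; split => //; move: gZ; apply: filterS => w -> _.
- apply/seteqP; split=> Z pZ.
    by have [LZ _] := pZ; split => // X cX; exact: CU_pairing cX pZ.
  by case: pZ => LZ h; split => // X KX; apply: h; exact: KU_CU.
apply/seteqP; split; last exact: polarV_CU.
move=> X cX; have [LX _] := cX; split => // q Mq; apply: CU_pairing cX _.
by have [] := coneP q (sub_cone Mq).
Qed.
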